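(* Fix $X\in\mathcal{E}$ and let $I$ be the (extended) Daniell integral associated with $X$. Then $C(\mathbb{R})\subseteq\mathbb{L}_u$, and for every continuous $f:\mathbb{R}\to\mathbb{R}$ we have $I(f)=f\circ X$; in particular $I(f)\in\mathcal{E}^u$.
   Context: Let $\mathcal{E}$ be an order complete vector lattice with a weak order unit $E$, $K$ its Stone space (extremally disconnected compact Hausdorff), and $C^\infty(K)$ the vector lattice of continuous functions $K\to[-\infty,\infty]$ finite off a nowhere dense set (identified when equal off a nowhere dense set), which is the universal completion $\mathcal{E}^u$. Fix a Maeda–Ogasawara representation of $\mathcal{E}$ as an order dense ideal of $C^\infty(K)$ with $E$ corresponding to $\mathbf{1}$. The sup-completion is $\mathcal{E}^s=\{f\in C(K,[-\infty,\infty]): f\ge g\text{ for some } g\in\mathcal{E}\}$. For $Y\in\mathcal{E}$, $P_Y$ denotes the band projection onto the band generated by $Y$. For a continuous $f:\mathbb{R}\to\mathbb{R}$ and $X\in C^\infty(K)$, $f\circ X$ denotes the unique element of $C^\infty(K)$ that agrees with $\omega\mapsto f(X(\omega))$ on the open dense set where $X$ is finite. Daniell calculus: $F(\mathbb{R})$ is the algebra of finite disjoint unions of intervals $(a,b]$, $(a,\infty)$, $(-\infty,b]$ ($a,b\in\mathbb{R}$), and $\mathbb{L}$ is the vector lattice of functions $f=\sum_{i=1}^n a_i\mathbf{1}_{S_i}$ with $a_i\in\mathbb{R}$ and $(S_i)$ a partition of $\mathbb{R}$ into sets of $F(\mathbb{R})$. For fixed $X\in\mathcal{E}$ the spectral system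 is $A_t=E-P_{(X-tE)^+}E$, with $A_\infty=\sup_tA_t$, $A_{-\infty}=\inf_tA_t$; the measure $\mu_A$ is $\mu_A(a,b]=A_b-A_a$, $\mu_A(a,\infty)=A_\infty-A_a$, $\mu_A(-\infty,b]=A_b-A_{-\infty}$, extended additively; the Daniell integral associated with $X$ is $I(f)=\sum_i a_i\mu_A(S_i)$ for $f=\sum_ia_i\mathbf{1}_{S_i}\in\mathbb{L}$. $\mathbb{L}^\uparrow$ is the set of $f:\mathbb{R}\to\overline{\mathbb{R}}$ for which there is a sequence $(f_n)\subseteq\mathbb{L}$ with $f_n(t)\uparrow f(t)$ for every $t$, and for such $f$, $I(f)=\sup_nI(f_n)\in\mathcal{E}^s$ (independent of the sequence). $\mathbb{L}^\uparrow_0$ is the set of real-valued positive functions in $\mathbb{L}^\uparrow$, $\mathbb{L}_u=\{g-h: g,h\in\mathbb{L}^\uparrow_0,\ I(g),I(h)\in\mathcal{E}^u\}$, and $I$ is extended to $\mathbb{L}_u$ by $I(g-h)=I(g)-I(h)$ (a well-defined positive linear map $\mathbb{L}_u\to\mathcal{E}^u$). *)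

(* Defs.v *)
From Stdlib Require Lists.List.
From mathcomp Require Import all_boot all_order all_algebra.
From mathcomp Require Import all_classical all_reals all_analysis.
Set Implicit Arguments. Unset Strict Implicit. Unset Printing Implicit Defensive.
Import Order.TTheory GRing.Theory Num.Theory.
Import numFieldNormedType.Exports.
Local Open Scope classical_set_scope.
Local Open Scope ring_scope.

Section Defs.
Variables (R : realType) (K : topologicalType).
Local Notation fK := (K -> \bar R).

Definition extremally_disconnected : Prop :=
  forall U : set K, open U -> open (closure U).

Definition nowhere_dense (S : set K) : Prop := interior (closure S) = set0.

(** C^oo(K): continuous K -> [-oo,+oo], finite off a nowhere dense set.
    (Two such functions equal off a nowhere dense set are equal everywhere
    by continuity, so no quotient is needed; order is pointwise.) *)
Definition Cinf (f : fK) : Prop :=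
  continuous f /\ nowhere_dense [set w | f w \isn't a fin_num].

Definition cle (f g : fK) : Prop := forall w, (f w <= g w)%E.
Definition czero : fK := fun _ => 0%E.
Definition cone : fK := fun _ => 1%E.

Definition cext (D : set K) (h : fK) : fK :=
  xget czero [set g | Cinf g /\ forall w, D w -> g w = h w].

Definition fin_set (f : fK) : set K := [set w | f w \is a fin_num].

Definition cadd (f g : fK) : fK :=
  cext (fin_set f `&` fin_set g) (fun w => (f w + g w)%E).
Definition cscale (c : R) (f : fK) : fK := fun w => (c%:E * f w)%E.
Definition cpos (f : fK) : fK := fun w => Order.max (f w) 0%E.
Definition cabs (f : fK) : fK := fun w => `|f w|%E.
Definition csub (f g : fK) : fK := cadd f (cscale (-1) g).
Definition csum (s : seq fK) : fK := foldr cadd czero s.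

Definition ccomp (f : R -> R) (X : fK) : fK :=
  cext (fin_set X) (fun w => (f (fine (X w)))%:E).

(** E as an order dense ideal of C^oo(K) containing 1 *)
Definition is_ideal_in (E B : set fK) : Prop :=
  B `<=` E /\ B czero /\
  (forall f g, B f -> B g -> B (cadd f g)) /\
  (forall c f, B f -> B (cscale c f)) /\
  (forall f g, B f -> E g -> (forall w, (`|g w| <= `|f w|)%E) -> B g).

Definition order_dense_in (E : set fK) : Prop :=
  forall g, Cinf g -> (forall w, (0 <= g w)%E) -> (exists w, g w != 0%E) ->
    exists f, E f /\ (forall w, (0 <= f w)%E /\ (f w <= g w)%E) /\
              exists w, f w != 0%E.

Definition lub_in (S A : set fK) (s : fK) : Prop :=
  S s /\ (forall a, A a -> cle a s) /\
  (forall u, S u -> (forall a, A a -> cle a u) -> cle s u).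
Definition glb_in (S A : set fK) (s : fK) : Prop :=
  S s /\ (forall a, A a -> cle s a) /\
  (forall u, S u -> (forall a, A a -> cle u a) -> cle u s).
Definition csup (S A : set fK) : fK := xget czero (lub_in S A).
Definition cinf (S A : set fK) : fK := xget czero (glb_in S A).

Definition is_band_in (E B : set fK) : Prop :=
  is_ideal_in E B /\ (forall A s, A `<=` B -> lub_in E A s -> B s).
Definition band_gen (E : set fK) (Y : fK) : set fK :=
  [set Z | forall B, is_band_in E B -> B Y -> B Z].
Definition band_disj (E : set fK) (Y : fK) : set fK :=
  [set Z | E Z /\ forall W, band_gen E Y W ->
                  forall w, Order.min `|Z w|%E `|W w|%E = 0%E].
Definition bandproj (E : set fK) (Y Z : fK) : fK :=
  xget czero [set P | band_gen E Y P /\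
                      exists Q, band_disj E Y Q /\ Z = cadd P Q].

Definition Esup (E : set fK) : set fK :=
  [set f | continuous f /\ exists g, E g /\ cle g f].

Definition spec (E : set fK) (X : fK) (t : R) : fK :=
  csub cone (bandproj E (cpos (csub X (cscale t cone))) cone).
Definition spec_pinfty E X : fK := csup E (range (spec E X)).
Definition spec_minfty E X : fK := cinf E (range (spec E X)).

Inductive ival := IOC of R & R | IOI of R | IIC of R.
Definition ival_set (i : ival) : set R :=
  match i with
  | IOC a b => [set t | a < t <= b]
  | IOI a => [set t | a < t]
  | IIC b => [set t | t <= b]
  end.
Definition ival_ok (i : ival) : bool :=
  if i is IOC a b then a < b else true.
Definition fset_of (s : seq ival) : set R :=
  [set t | exists2 i, Stdlib.Lists.List.In i s & ival_set i t].
Definition fset_ok (s : seq ival) : Prop :=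
  all ival_ok s /\
  forall m n, (m < n < size s)%N ->
    ival_set (nth (IIC 0) s m) `&` ival_set (nth (IIC 0) s n) = set0.

Definition mu_ival (E : set fK) (X : fK) (i : ival) : fK :=
  match i with
  | IOC a b => csub (spec E X b) (spec E X a)
  | IOI a => csub (spec_pinfty E X) (spec E X a)
  | IIC b => csub (spec E X b) (spec_minfty E X)
  end.
Definition mu_fset (E : set fK) (X : fK) (s : seq ival) : fK :=
  csum [seq mu_ival E X i | i <- s].

Definition step_rep (f : R -> R) (r : seq (R * seq ival)) : Prop :=
  (forall p, Stdlib.Lists.List.In p r -> fset_ok p.2) /\
  (forall m n, (m < n < size r)%N ->
     fset_of (nth (0, [::]) r m).2 `&` fset_of (nth (0, [::]) r n).2 = set0) /\
  (forall t, exists2 p, Stdlib.Lists.List.In p r & fset_of p.2 t) /\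
  (forall t, f t = \sum_(p <- r) p.1 * \1_(fset_of p.2) t).

Definition inL (f : R -> R) : Prop := exists r, step_rep f r.

Definition IL (E : set fK) (X : fK) (f : R -> R) : fK :=
  xget czero [set v | exists r, step_rep f r /\
     v = csum [seq cscale p.1 (mu_fset E X p.2) | p <- r]].

Definition up_seq (f : R -> \bar R) (fn : nat -> R -> R) : Prop :=
  (forall n, inL (fn n)) /\
  (forall n t, fn n t <= fn n.+1 t) /\
  (forall t, (fun n => (fn n t)%:E) @ \oo --> f t).
Definition inLup (f : R -> \bar R) : Prop := exists fn, up_seq f fn.
Definition Iup (E : set fK) (X : fK) (f : R -> \bar R) : fK :=
  xget czero [set v | exists fn, up_seq f fn /\
     lub_in (Esup E) (range (fun n => IL E X (fn n))) v].

Definition inLup0 (g : R -> R) : Prop :=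
  (forall t, 0 <= g t) /\ inLup (fun t => (g t)%:E).

Definition Lu_dec (E : set fK) (X : fK) (f g h : R -> R) : Prop :=
  inLup0 g /\ inLup0 h /\
  Cinf (Iup E X (fun t => (g t)%:E)) /\ Cinf (Iup E X (fun t => (h t)%:E)) /\
  f = g \- h.
Definition inLu (E : set fK) (X : fK) (f : R -> R) : Prop :=
  exists g h, Lu_dec E X f g h.
Definition Iu (E : set fK) (X : fK) (f : R -> R) : fK :=
  xget czero [set v | exists g h, Lu_dec E X f g h /\
     v = csub (Iup E X (fun t => (g t)%:E)) (Iup E X (fun t => (h t)%:E))].

End Defs.

(* Main.v *)
(** Call a property of points of [K] generic if it holds on a countable
    intersection of open dense sets.  By the Baire property of compact Hausdorff
    spaces, two continuous functions [K -> \bar R] that agree generically are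
    equal, so every identity in the universal completion may be checked
    generically.  Generically the spectral element [A_t] is the indicator of
    [X <= t]; hence [I phi = phi o X] generically for a step function [phi].
    Suprema of sequences in [C(K, \bar R)] agree generically with pointwise
    suprema, because the frontier of an open set is nowhere dense; hence
    [I phi = phi o X] generically also for [phi] in [L^up], whatever
    approximating sequence is chosen, and for differences of such functions.  Finally a
    nonnegative continuous function is the supremum of the countably many
    functions [a * 1_(p, q]] below it with rational [a], [p], [q]. *)

Require Import Defs.
From mathcomp Require Import all_boot all_order all_algebra.
From mathcomp Require Import all_classical all_reals all_analysis.
From mathcomp Require Import lra.
(* [cadd] and [cscale] are shadowed by the operations on charges. *)
Import Defs.
Import Order.TTheory GRing.Theory Num.Theory.
Import numFieldNormedType.Exports.
Local Open Scope classical_set_scope.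
Local Open Scope ring_scope.

Set Implicit Arguments.
Unset Strict Implicit.
Unset Printing Implicit Defensive.

(** * Generic sets and the Baire property *)

Section Generic.
Variable K : topologicalType.
Implicit Types P Q U O : set K.

Definition generic P : Prop :=
  exists2 U : nat -> set K, (forall n, open (U n) /\ dense (U n)) &
    \bigcap_n U n `<=` P.

Lemma generic_open_dense U : open U -> dense U -> generic U.
Proof. by move=> oU dU; exists (fun=> U) => // w /(_ 0%N I). Qed.

Lemma genericS P Q : P `<=` Q -> generic P -> generic Q.
Proof. by move=> PQ [U oU UP]; exists U => // w /UP/PQ. Qed.

Lemma dense_setT : dense [set: K].
Proof. by move=> O O0 _; rewrite setIT. Qed.

Lemma genericT P : (forall w, P w) -> generic P.
Proof.
by move=> PT; apply: genericS (generic_open_dense openT dense_setT) => w _.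
Qed.

Lemma generic_forall (T : countType) (P : T -> set K) :
  (forall i, generic (P i)) -> generic [set w | forall i, P i w].
Proof.
move=> gP.
have /choice[U HU] : forall i, exists U : nat -> set K,
    (forall n, open (U n) /\ dense (U n)) /\ \bigcap_n U n `<=` P i.
  by move=> i; case: (gP i) => U *; exists U.
(* A pairing merges the countably many sequences into one; numbers that code no pair get the whole
   space. *)
pose V k := if @unpickle (T * nat)%type k is Some p then U p.1 p.2 else setT.
exists V.
- move=> k; rewrite /V; case: (unpickle k) => [[i n]|] /=.
  + exact: (HU i).1.
  + by split; [exact: openT|exact: dense_setT].
- move=> w Vw i; apply: (HU i).2 => n _.
  by have := Vw (pickle (i, n)) I; rewrite /V pickleK.
Qed.

Lemma genericI P Q : generic P -> generic Q -> generic (P `&` Q).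
Proof.
move=> gP gQ.
have /genericS : generic [set w | forall b : bool, (if b then P else Q) w].
  by apply: generic_forall => -[].
by apply=> w H; split; [exact: (H true)|exact: (H false)].
Qed.

(** [O] together with its exterior is open and dense, and only frontier points are left out. *)
Lemma frontier_generic O : open O -> generic [set w | closure O w -> O w].
Proof.
move=> oO; apply: genericS (@generic_open_dense (O `|` ~` closure O) _ _).
- by move=> w [Ow _|nOw /nOw].
- by apply: openU => //; apply: closed_openC; exact: closed_closure.
- move=> V [w Vw] oV; have [cOw|ncOw] := pselect (closure O w).
  + have [v [Ov Vv]] := cOw V (open_nbhs_nbhs (conj oV Vw)).
    by exists v; split => //; left.
  + by exists w; split => //; right.
Qed.

Hypotheses (Kc : compact [set: K]) (KT2 : hausdorff_space K).

(** Regularity of compact Hausdorff spaces, in the form of one step of the Baire construction. *)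
Lemma compact_shrink O U : open O -> O !=set0 -> open U -> dense U ->
  exists V : set K, [/\ open V, V !=set0 & closure V `<=` O `&` U].
Proof.
move=> oO O0 oU dU; have [w [Ow Uw]] := dU O O0 oO.
have wOU : nbhs w (O `&` U).
  by apply: open_nbhs_nbhs; split => //; exact: openI.
have [V wV cV] := compact_regular KT2 Kc (@filterT _ _ (nbhs_filter w)) wOU.
exists V^°; split; first exact: open_interior.
- by exists w.
- exact: subset_trans (closureS (@interior_subset _ _)) cV.
Qed.

(** Baire category theorem: nonempty open sets [V n] are chosen from [O] on, the closure of each
    inside the previous one and inside a set [U n]. By compactness the filter they generate has a
    cluster point, which lies in all of them. *)
Lemma generic_dense P : generic P -> dense P.
Proof.
move=> [U oU UP] O O0 oO.
(* The choice is made for every pair [(n, W)], with openness and nonemptiness as premises, so that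
   [V] below is a plain recursion. *)
have /choice[s Hs] : forall x : nat * set K, exists V : set K,
    open x.2 -> x.2 !=set0 ->
    [/\ open V, V !=set0 & closure V `<=` x.2 `&` U x.1].
  move=> [n W] /=; have [[oW W0]|nW] := pselect (open W /\ W !=set0).
    have [V HV] := compact_shrink oW W0 (oU n).1 (oU n).2.
    by exists V.
  by exists set0 => oW W0; case: nW.
pose V := fix V n := if n is m.+1 then s (m, V m) else O.
have HV n : open (V n) /\ V n !=set0.
  by elim: n => //= n [oV V0]; have [] := Hs (n, V n) oV V0.
have cV n : closure (V n.+1) `<=` V n `&` U n.
  by have [oV V0] := HV n; have [] := Hs (n, V n) oV V0.
have VS m n : (m <= n)%N -> V n `<=` V m.
  move=> /subnKC <-; elim: (n - m)%N => [|k IH]; first by rewrite addn0.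
  rewrite addnS; apply: subset_trans IH => w /subset_closure /cV [] //.
pose F := filter_from [set: nat] V.
have FF : ProperFilter F.
  apply: filter_from_proper => [|n _]; last exact: (HV n).2.
  apply: filter_from_filter; first by exists 0%N.
  move=> i j _ _; exists (maxn i j) => // w Vw.
  by split; apply: VS Vw; rewrite ?leq_maxl ?leq_maxr.
have [w [_ Fw]] := Kc FF filterT.
have VUw n : (V n `&` U n) w.
  by apply: cV => W wW; apply: (Fw (V n.+1) W) => //; exists n.+1.
exists w; split; first by have [] := VUw 0%N.
by apply: UP => n _; have [] := VUw n.
Qed.

End Generic.

(** * Continuous functions with extended real values *)

Section ErealContinuity.
Context {R : realType} {K : topologicalType}.
Implicit Types (f g s : K -> \bar R).

Lemma continuous_open_gt f (a : \bar R) :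
  continuous f -> open [set w | (a < f w)%E].
Proof. by move=> /continuousP cf; exact: (cf _ (@open_ereal_gt_ereal R a)). Qed.

Lemma continuous_open_lt f (a : \bar R) :
  continuous f -> open [set w | (f w < a)%E].
Proof. by move=> /continuousP cf; exact: (cf _ (@open_ereal_lt_ereal R a)). Qed.

(** The separating points are rational, so that families of conditions indexed by them stay
    countable. *)
Lemma EFin_between (x y : \bar R) :
  (x < y)%E -> exists2 q : rat, (x < (ratr q)%:E)%E & ((ratr q)%:E < y)%E.
Proof.
have aux (a b : R) : a < b -> exists2 q : rat, a < ratr q & ratr q < b.
  by move=> /rat_in_itvoo[q]; rewrite in_itv/= => /andP[]; exists q.
case: x y => [x| |] [y| |] //=; rewrite ?lte_fin.
- by move=> /aux[q]; exists q; rewrite lte_fin.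
- have [|q qx _] := aux x (x + 1); first by rewrite ltrDl.
  by exists q; rewrite ?lte_fin// ltry.
- have [|q _ qx] := aux (y - 1) y; first by rewrite gtrBl.
  by exists q; rewrite ?lte_fin// ltNyr.
- by exists 0; rewrite ?ltry ?ltNyr.
Qed.

(** Open rays with finite endpoints form a subbase of the topology of [\bar R]. *)
Lemma continuous_ereal_open f :
  (forall a : R, open [set w | (a%:E < f w)%E]) ->
  (forall a : R, open [set w | (f w < a%:E)%E]) -> continuous f.
Proof.
move=> fgt flt w A.
have near_gt (a : R) : (a%:E < f w)%E -> \forall v \near w, (a%:E < f v)%E.
  by move=> aw; apply: open_nbhs_nbhs; split => //; exact: fgt.
have near_lt (a : R) : (f w < a%:E)%E -> \forall v \near w, (f v < a%:E)%E.
  by move=> aw; apply: open_nbhs_nbhs; split => //; exact: flt.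
rewrite /nbhs/= /nbhs/= /ereal_nbhs/=.
case fwE : (f w) => [r| |].
- move=> /nbhs_ballP[e /= e0 eA].
  apply: filterS (filterI (near_gt (r - e) _) (near_lt (r + e) _)).
  + move=> v [] /=; case: (f v) => [x| |] //=; rewrite !lte_fin => h1 h2.
    by apply: eA; rewrite /ball/= ltr_norml; lra.
  + by rewrite fwE lte_fin gtrBl.
  + by rewrite fwE lte_fin ltrDl.
- move=> [M [_ MA]]; have /near_gt : (M%:E < f w)%E by rewrite fwE ltry.
  by apply: filterS => v /MA.
- move=> [M [_ MA]]; have /near_lt : (f w < M%:E)%E by rewrite fwE ltNyr.
  by apply: filterS => v /MA.
Qed.

(** If [g w < q < f w], then [g < q < f] holds on an open neighbourhood of [w], which meets [P]. *)
Lemma dense_cle f g (P : set K) : continuous f -> continuous g -> dense P ->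
  (forall w, P w -> (f w <= g w)%E) -> cle f g.
Proof.
move=> cf cg dP fgP w; rewrite leNgt; apply/negP => /EFin_between[q gq qf].
have [v [/= [qfv gqv] Pv]] := dP
    ([set w | ((ratr q)%:E < f w)%E] `&` [set w | (g w < (ratr q)%:E)%E])
    (ex_intro _ w (conj qf gq))
    (openI (continuous_open_gt _ cf) (continuous_open_lt _ cg)).
by have := lt_le_trans qfv (fgP v Pv); rewrite ltNge (ltW gqv).
Qed.

Lemma patch_continuous (C : set K) f g : open C -> closed C ->
  continuous f -> continuous g ->
  continuous (fun w => if w \in C then f w else g w).
Proof.
move=> oC cC /continuousP cf /continuousP cg; apply/continuousP => A oA.
rewrite (_ : _ @^-1` A = (C `&` f @^-1` A) `|` (~` C `&` g @^-1` A)).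
  by apply: openU; apply: openI;
    [|exact: cf|exact: closed_openC|exact: cg].
apply/seteqP; split => w /=.
- by case: (boolP (w \in C)); rewrite ?inE ?notin_setE; [left|right].
- by case: (boolP (w \in C)); rewrite ?inE ?notin_setE => Cw [[]|[]].
Qed.

End ErealContinuity.

(** * Regularization of lower semicontinuous functions *)

Section Regularization.
Context {R : realType} {K : topologicalType}.
Implicit Types (f g h s u : K -> \bar R).

(* For lower semicontinuous [s] over an extremally disconnected space this is
   the upper semicontinuous regularization of [s], and it is continuous. *)
Definition creg s : K -> \bar R := fun w =>
  ereal_sup [set q%:E | q in [set q : R | closure [set v | (q%:E < s v)%E] w]].

Lemma creg_ge_closure s w (q : R) :
  closure [set v | (q%:E < s v)%E] w -> (q%:E <= creg s w)%E.
Proof. by move=> sq; apply: ereal_sup_ubound; exists q. Qed.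

Lemma creg_gt s w (a : \bar R) : (a < creg s w)%E ->
  exists2 q : R, (a < q%:E)%E & closure [set v | (q%:E < s v)%E] w.
Proof. by move=> /ereal_sup_gt[_ [q sq <-] aq]; exists q. Qed.

Lemma creg_ge s w : (s w <= creg s w)%E.
Proof.
rewrite leNgt; apply/negP => /EFin_between[q cq qs].
have := @creg_ge_closure s w (ratr q); rewrite leNgt cq.
move=> /(_ _)/negP; apply => //.
exact: subset_closure.
Qed.

Lemma creg_le_near s w (a : \bar R) :
  (\forall v \near w, (s v <= a)%E) -> (creg s w <= a)%E.
Proof.
move=> sa; rewrite leNgt; apply/negP => /creg_gt[q aq sq].
have [v [/= qv va]] := sq _ sa.
by have := lt_le_trans qv va; rewrite ltNge (ltW aq).
Qed.

(** Together with [creg_ge], this makes [creg s], once continuous, the least continuous majorant of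
    [s]. *)
Lemma creg_le_continuous s u : continuous u -> cle s u -> cle (creg s) u.
Proof.
move=> cu su w; rewrite leNgt; apply/negP => /EFin_between[q uq].
apply/negP; rewrite -leNgt; apply: creg_le_near.
have : \forall v \near w, (u v < (ratr q)%:E)%E.
  by apply: open_nbhs_nbhs; split => //; exact: continuous_open_lt.
by apply: filterS => v /ltW; exact: le_trans.
Qed.

Lemma closure_gt_le s w (p q : R) : p <= q ->
  closure [set v | (q%:E < s v)%E] w -> closure [set v | (p%:E < s v)%E] w.
Proof. by move=> pq; apply: closureS => v /=; apply: le_lt_trans. Qed.

(** Rays pull back to unions over [q]: of closures of the open sets [q < s], which are open by
    extremal disconnectedness, and of complements of such closures, which are open in any space. *)
Lemma creg_continuous s : extremally_disconnected K ->
  lower_semicontinuous s -> continuous (creg s).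
Proof.
move=> ED /lower_semicontinuousP sl; apply: continuous_ereal_open => a.
- rewrite (_ : [set _ | _] = \bigcup_(q in [set q : R | a < q])
      closure [set v | (q%:E < s v)%E]).
    by apply: bigcup_open => q _; exact: ED.
  apply/seteqP; split => w /=.
  + by move=> /creg_gt[q aq sq]; exists q.
  + by move=> [q /= aq /creg_ge_closure]; apply: lt_le_trans; rewrite lte_fin.
- rewrite (_ : [set _ | _] = \bigcup_(q in [set q : R | q < a])
      ~` closure [set v | (q%:E < s v)%E]).
    by apply: bigcup_open => q _; apply: closed_openC; exact: closed_closure.
  apply/seteqP; split => w /=.
  + move=> /EFin_between[q wq qa]; exists (ratr q) => //= /creg_ge_closure.
    by rewrite leNgt wq.
  + move=> [q /= qa nq]; apply: (@le_lt_trans _ _ q%:E); last exact: qa.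
    rewrite leNgt; apply/negP => /creg_gt[p qp /closure_gt_le H]; apply: nq.
    by apply: H; rewrite -lee_fin ltW.
Qed.

(** Rational [q] suffice: off the frontiers of the open sets [q < s], no rational lies strictly
    between [s w] and [creg s w]. *)
Lemma creg_generic s : lower_semicontinuous s ->
  generic [set w | creg s w = s w].
Proof.
move=> /lower_semicontinuousP sl.
have /genericS : generic [set w | forall q : rat,
    closure [set v | ((ratr q)%:E < s v)%E] w -> ((ratr q)%:E < s w)%E].
  by apply: generic_forall => q; exact: frontier_generic.
apply=> w /= H; apply/eqP; rewrite eq_le creg_ge andbT leNgt; apply/negP.
move=> /EFin_between[q wq] /creg_gt[p qp sp].
have /H : closure [set v | ((ratr q)%:E < s v)%E] w.
  by apply: closure_gt_le sp; rewrite -lee_fin ltW.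
by rewrite ltNge (ltW wq).
Qed.

End Regularization.

(** * The space [Cinf] and operations defined by extension from dense open sets *)

Section Cinf.
Context {R : realType} {K : topologicalType}.
Implicit Types (f g h s u : K -> \bar R) (C D : set K).

Lemma fin_set_open f : continuous f -> open (fin_set f).
Proof.
move=> cf.
rewrite (_ : fin_set f = [set w | (-oo < f w)%E] `&` [set w | (f w < +oo)%E]).
  by apply: openI; [exact: continuous_open_gt|exact: continuous_open_lt].
by apply/seteqP; split => w /=; rewrite /fin_set/= fin_numElt => /andP.
Qed.

Lemma Cinf_fin_dense f : Cinf f -> dense (fin_set f).
Proof.
move=> [cf nf] O [w Ow] oO; apply: contrapT => /forallNP Of.
suff : (closure [set w | f w \isn't a fin_num])^° w by rewrite nf.
apply: filterS (open_nbhs_nbhs (conj oO Ow)).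
move=> v Ov; apply: subset_closure => /=; apply/negP => fv.
by apply: (Of v); split.
Qed.

(** The set of infinite values is closed, hence nowhere dense as soon as its complement contains a
    dense set. *)
Lemma CinfI f D : continuous f -> dense D -> (forall w, D w -> fin_set f w) ->
  Cinf f.
Proof.
move=> cf dD Df; split => //.
rewrite /nowhere_dense -(closure_id _).1; last first.
  rewrite (_ : [set _ | _] = ~` fin_set f).
    by apply: open_closedC; exact: fin_set_open.
  by apply/seteqP; split => w /=; rewrite /fin_set/= => /negP.
apply/seteqP; split => // w Sw.
have [v [/interior_subset/negP Sv Dv]] :=
  dD _ (ex_intro _ w Sw) (@open_interior _ _).
by apply: Sv; exact: Df.
Qed.

Lemma Cinf_generic_fin f : Cinf f -> generic (fin_set f).
Proof.
move=> Cf; apply: generic_open_dense; last exact: Cinf_fin_dense.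
by apply: fin_set_open; case: Cf.
Qed.

Lemma fin_Cinf f : continuous f -> (forall w, f w \is a fin_num) -> Cinf f.
Proof.
by move=> cf ff; apply: (CinfI cf (@dense_setT K)) => w _; exact: ff.
Qed.

Lemma cscale_Cinf (c : R) f : Cinf f -> Cinf (cscale c f).
Proof.
move=> Cf; apply: (@CinfI _ (fin_set f)).
- by move=> w; apply: continuous_comp; [exact: Cf.1|exact: mule_continuous].
- exact: Cinf_fin_dense.
- by move=> w fw; rewrite /fin_set/= /cscale fin_numM.
Qed.

Lemma cpos_Cinf f : Cinf f -> Cinf (cpos f).
Proof.
move=> Cf.
have open_cst (P : Prop) : open [set _ : K | P].
  have [p|np] := pselect P.
  - by rewrite (_ : [set _ | _] = setT); [exact: openT|apply/seteqP; split].
  - by rewrite (_ : [set _ | _] = set0); [exact: open0|apply/seteqP; split].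
apply: (@CinfI _ (fin_set f)).
- apply: continuous_ereal_open => a.
  + rewrite (_ : [set _ | _] =
        [set w | (a%:E < f w)%E] `|` [set w | (a%:E < 0)%E]); last first.
      by apply/seteqP; split => w /=; rewrite /cpos lt_max => /orP.
    by apply: openU => //; exact: (continuous_open_gt _ Cf.1).
  + rewrite (_ : [set _ | _] =
        [set w | (f w < a%:E)%E] `&` [set w | (0 < a%:E)%E]); last first.
      by apply/seteqP; split => w /=; rewrite /cpos gt_max => /andP.
    by apply: openI => //; exact: (continuous_open_lt _ Cf.1).
- exact: Cinf_fin_dense.
- by move=> w; rewrite /fin_set/= /cpos; case: leP.
Qed.

Definition cind C : K -> \bar R := fun w => if w \in C then 1%E else 0%E.

Lemma cind_in C w : C w -> cind C w = 1%E.
Proof. by move=> Cw; rewrite /cind mem_set. Qed.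

Lemma cind_out C w : ~ C w -> cind C w = 0%E.
Proof. by move=> Cw; rewrite /cind memNset. Qed.

Lemma cind_ge0 C w : (0 <= cind C w)%E.
Proof. by rewrite /cind; case: ifP; rewrite // lee01. Qed.

Lemma cind_le1 C w : (cind C w <= 1)%E.
Proof. by rewrite /cind; case: ifP; rewrite // lee01. Qed.

Lemma cind_Cinf C : open C -> closed C -> Cinf (cind C).
Proof.
move=> oC cC; apply: fin_Cinf; last by move=> w; rewrite /cind; case: ifP.
by apply: patch_continuous => // w; exact: cvg_cst.
Qed.

Hypothesis KED : extremally_disconnected K.

(** An extension exists: [h], set to [-oo] off [D], is lower semicontinuous, and its regularization
    is continuous and still equals [h] on [D], because [h] is continuous there. *)
Lemma cext_spec D h : open D -> dense D ->
  (forall w, D w -> {for w, continuous h}) ->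
  (forall w, D w -> h w \is a fin_num) ->
  Cinf (cext D h) /\ forall w, D w -> cext D h w = h w.
Proof.
move=> oD dD ch hf; apply: (@xgetPex _ (@czero R K)
  [set g | Cinf g /\ forall w, D w -> g w = h w]).
(* The value [-oo] off [D] keeps each set [a < s] inside the open set [D]. *)
pose s w := if w \in D then h w else -oo%E.
have sE w : D w -> s w = h w by move=> Dw; rewrite /s mem_set.
have sl : lower_semicontinuous s.
  apply/lower_semicontinuousP => a.
  rewrite (_ : [set _ | _] = D `&` h @^-1` [set y | (a%:E < y)%E]).
    apply: (continuous_inP h oD).1; last exact: (@open_ereal_gt_ereal R a%:E).
    by move=> w; rewrite inE => /ch.
  apply/seteqP; split => w /=; last by case=> Dw; rewrite sE.
  by rewrite /s; case: ifPn; rewrite ?inE// ltNge leNye.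
have cE w : D w -> creg s w = h w.
  move=> Dw; apply/eqP; rewrite eq_le -{2}(sE w Dw) creg_ge andbT.
  rewrite leNgt; apply/negP => /EFin_between[q hq]; apply/negP.
  rewrite -leNgt; apply: creg_le_near.
  have Dn : nbhs w D by apply: open_nbhs_nbhs.
  have : \forall v \near w, (h v < (ratr q)%:E)%E.
    apply: (ch w Dw [set y | (y < (ratr q)%:E)%E]); apply: open_nbhs_nbhs.
    by split => //; exact: open_ereal_lt_ereal.
  by apply: filterS2 Dn => v Dv /ltW; rewrite sE.
exists (creg s); split => //.
apply: (CinfI (creg_continuous KED sl) dD) => w Dw.
by rewrite /fin_set/= cE// hf.
Qed.

Lemma cadd_spec f g : Cinf f -> Cinf g -> Cinf (cadd f g) /\
  forall w, f w \is a fin_num -> g w \is a fin_num ->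
    cadd f g w = (f w + g w)%E.
Proof.
move=> Cf Cg.
have [] := @cext_spec (fin_set f `&` fin_set g) (fun w => (f w + g w)%E).
- by apply: openI; apply: fin_set_open; [exact: Cf.1|exact: Cg.1].
- apply: denseI; [exact: fin_set_open Cf.1| |]; exact: Cinf_fin_dense.
- move=> w [fw gw]; apply: cvgeD; [|exact: Cf.1|exact: Cg.1].
  exact: fin_num_adde_defl.
- by move=> w [fw gw]; rewrite fin_numD fw.
- by move=> C H; split => // w fw gw; apply: H; split.
Qed.

Lemma csub_spec f g : Cinf f -> Cinf g -> Cinf (csub f g) /\
  forall w, f w \is a fin_num -> g w \is a fin_num ->
    csub f g w = (f w - g w)%E.
Proof.
move=> Cf Cg; have [C H] := cadd_spec Cf (cscale_Cinf (-1) Cg).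
split => // w fw gw; rewrite /csub H//; last by rewrite fin_numM.
by rewrite /cscale EFinN mulN1e.
Qed.

Lemma ccomp_spec (phi : R -> R) f : continuous phi -> Cinf f ->
  Cinf (ccomp phi f) /\
  forall w, f w \is a fin_num -> ccomp phi f w = (phi (fine (f w)))%:E.
Proof.
move=> cphi Cf; apply: cext_spec => //.
- exact: fin_set_open Cf.1.
- exact: Cinf_fin_dense.
- move=> w fw.
  have cf : {for w, continuous (fine \o f)}.
    by apply: fine_cvg; rewrite fineK//; exact: Cf.1.
  by apply: cvg_EFin; [exact: nearW|exact: (continuous_comp cf (cphi _))].
Qed.

Hypotheses (Kc : compact [set: K]) (KT2 : hausdorff_space K).

Lemma generic_cle f g : continuous f -> continuous g ->
  generic [set w | (f w <= g w)%E] -> cle f g.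
Proof. by move=> cf cg /(generic_dense Kc KT2)/dense_cle; exact. Qed.

Lemma cle_anti f g : cle f g -> cle g f -> f = g.
Proof. by move=> fg gf; apply/funext => w; apply/le_anti; rewrite fg gf. Qed.

Lemma generic_eq f g : continuous f -> continuous g ->
  generic [set w | f w = g w] -> f = g.
Proof.
move=> cf cg fg; apply: cle_anti; apply: generic_cle => //;
  by apply: genericS fg => w /= ->.
Qed.

End Cinf.

(** * Bands and band projections in the ideal [E] *)

Section Ideal.
Context {R : realType} {K : topologicalType}.
Hypotheses (Kc : compact [set: K]) (KT2 : hausdorff_space K).
Hypothesis KED : extremally_disconnected K.
Variable E : set (K -> \bar R).
Hypotheses (EI : is_ideal_in (@Cinf R K) E) (E1 : E (@cone R K)).
Implicit Types (f g s u Y Z : K -> \bar R) (C V : set K).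

Lemma ideal_Cinf f : E f -> Cinf f. Proof. exact: EI.1. Qed.

Lemma ideal_continuous f : E f -> continuous f. Proof. by case/ideal_Cinf. Qed.

Lemma ideal_czero : E (@czero R K). Proof. by case: EI => _ []. Qed.

Lemma ideal_cadd f g : E f -> E g -> E (cadd f g).
Proof. by case: EI => _ [_ [H _]]; exact: H. Qed.

Lemma ideal_cscale c f : E f -> E (cscale c f).
Proof. by case: EI => _ [_ [_ [H _]]]; exact: H. Qed.

Lemma ideal_solid f g : E f -> Cinf g -> (forall w, `|g w| <= `|f w|)%E -> E g.
Proof. by case: EI => _ [_ [_ [_ H]]]; exact: H. Qed.

Lemma ideal_cind C : open C -> closed C -> E (cind C).
Proof.
move=> oC cC; apply: ideal_solid E1 (cind_Cinf oC cC) _ => w.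
by rewrite (gee0_abs (cind_ge0 _ _)) /cone abse1 cind_le1.
Qed.

(** A supremum [s] of such functions, reset to zero on the clopen set [V], still lies in [E] and is
    still an upper bound; hence [s] is zero on [V]. *)
Lemma vanishing_band V : open V -> closed V ->
  is_band_in E [set Z | E Z /\ forall w, V w -> Z w = 0%E].
Proof.
move=> oV cV; split.
  split; first by move=> Z [].
  split; first by split => //; exact: ideal_czero.
  split.
    move=> f g [Ef f0] [Eg g0]; split; first exact: ideal_cadd.
    move=> w Vw; have [_ ->] := cadd_spec KED (ideal_Cinf Ef) (ideal_Cinf Eg).
    - by rewrite f0// g0// adde0.
    - by rewrite f0.
    - by rewrite g0.
  split.
    move=> c f [Ef f0]; split; first exact: ideal_cscale.
    by move=> w Vw; rewrite /cscale f0// mule0.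
  move=> f g [Ef f0] Eg gf; split => // w Vw.
  by apply/eqP; rewrite -abse_eq0 eq_le abse_ge0 andbT; have := gf w;
    rewrite f0// abse0.
move=> A s AB [Es [As sA]]; split => //.
have [[a Aa]|A0] := pselect (A !=set0).
- move=> w Vw; pose u v := if v \in V then 0%E else s v.
  have Eu : E u.
    apply: (ideal_solid Es) => [|v]; last first.
      by rewrite /u; case: ifP; rewrite // abse0.
    apply: (@CinfI _ _ _ (fin_set s)).
    + apply: (@patch_continuous _ _ V (fun=> 0%E) s oV cV).
      * by move=> ?; exact: cvg_cst.
      * exact: (ideal_continuous Es).
    + exact/Cinf_fin_dense/ideal_Cinf.
    + by move=> v sv; rewrite /fin_set/= /u; case: ifP.
  have su : cle s u.
    apply: sA => // b Ab v; rewrite /u; case: ifPn; last by move=> _; exact: As.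
    by rewrite inE => Vv; have [_ ->] := AB b Ab.
  apply/le_anti; have := su w; rewrite /u mem_set// => ->.
  by have := As a Aa w; have [_ ->] := AB a Aa.
(* For empty [A], [s] would be a least element of [E]. Where it is finite, it would be at most [-1]
   and at most its own double, which is absurd. *)
- move=> w _; have sle u : E u -> cle s u.
    by move=> Eu; apply: sA => // a Aa; case: A0; exists a.
  have [v [_ sv]] := Cinf_fin_dense (ideal_Cinf Es) (ex_intro setT w I) openT.
  have := sle _ (ideal_cscale (-1) E1) v; have := sle _ (ideal_cscale 2 Es) v.
  rewrite /cscale /cone mule1; move: sv; rewrite /fin_set/=.
  by case: (s v) => //= r _; rewrite -EFinM !lee_fin => h1 h2; exfalso; lra.
Qed.

Lemma neq0_open Y : continuous Y -> open [set w | Y w != 0%E].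
Proof.
move=> cY; rewrite (_ : [set _ | _] =
    [set w | (Y w < 0)%E] `|` [set w | (0 < Y w)%E]).
  by apply: openU; [exact: continuous_open_lt|exact: continuous_open_gt].
by apply/seteqP; split => w /=; rewrite neq_lt => /orP.
Qed.

Lemma closure_clopen (O : set K) : open O ->
  [/\ open (closure O), closed (closure O),
      open (~` closure O) & closed (~` closure O)].
Proof.
move=> oO; have cO := @closed_closure _ O; split => //; first exact: KED.
- exact: closed_openC.
- by apply: open_closedC; exact: KED.
Qed.

(** The functions vanishing off the closed support of [Y] form a band that contains [Y]. *)
Lemma band_gen_vanish Y Z w : E Y -> band_gen E Y Z ->
  ~ closure [set v | Y v != 0%E] w -> Z w = 0%E.
Proof.
move=> EY YZ; have := closure_clopen (neq0_open (ideal_continuous EY)).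
move=> [_ _ oC cC]; have [|_] := YZ _ (vanishing_band oC cC); last exact.
split => // v; apply: contra_notP => /eqP Yv; exact: subset_closure.
Qed.

Lemma band_gen_ideal Y Z : E Y -> band_gen E Y Z -> E Z.
Proof.
(* Vanishing on the empty set is no condition, so the band used here is [E] itself. *)
by move=> EY YZ; have [] := YZ _ (vanishing_band open0 closed0).
Qed.

(* The indicator of the support of [Y] is the supremum of the indicators of
   [closure {1/n < |Y|}], which [n |Y|] dominates. *)
Lemma band_gen_support Y : E Y ->
  band_gen E Y (cind (closure [set w | Y w != 0%E])).
Proof.
move=> EY B [BI Bsup] BY; set C := closure _.
have cY := ideal_continuous EY.
have [oC cC _ _] := closure_clopen (neq0_open cY).
have cabsY : continuous (fun w => `|Y w|%E).
  by move=> w; apply: continuous_comp; [exact: cY|exact: abse_continuous].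
pose O n := [set w | ((n.+1%:R^-1)%:E < `|Y w|)%E].
have oO n : open (O n) by exact: continuous_open_gt.
have clO := fun n => closure_clopen (oO n).
apply: (Bsup (range (fun n => cind (closure (O n))))).
- move=> _ [n _ <-]; have [oOn cOn _ _] := clO n.
  have [_ [_ [_ [Bscale Bsolid]]]] := BI.
  apply: (Bsolid (cscale n.+1%:R Y)); [exact: Bscale|exact: ideal_cind|].
  apply: (generic_cle Kc KT2).
  + by move=> w; apply: continuous_comp;
      [exact: (cind_Cinf oOn cOn).1|exact: abse_continuous].
  + by move=> w; apply: continuous_comp;
      [exact/ideal_continuous/ideal_cscale|exact: abse_continuous].
  (* Generically, points of the closure of [O n] lie in [O n], where [(n + 1) |Y|] exceeds 1. *)
  + apply: genericS (frontier_generic (oO n)) => w /= Ow.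
    rewrite (gee0_abs (cind_ge0 _ _)).
    have [/[dup] cw /Ow/ltW Yw|nw] := pselect (closure (O n) w).
    * rewrite cind_in// /cscale abseM gee0_abs ?lee_fin//.
      by rewrite -lee_pdivrMl ?mule1.
    * by rewrite cind_out// abse_ge0.
- split; first exact: ideal_cind.
  split=> [_ [n _ <-] w|u Eu uO].
  + have [cw|nw] := pselect (closure (O n) w); last first.
      by rewrite (cind_out nw) cind_ge0.
    rewrite cind_in ?cind_le1// cind_in//; apply: closureS cw => v.
    rewrite /O/= => Yv; apply/negP => /eqP Y0; move: Yv.
    by rewrite Y0 abse0 lte_fin ltNge invr_ge0 ler0n.
  + apply: (generic_cle Kc KT2); [exact: (cind_Cinf oC cC).1|
      exact: ideal_continuous|].
    apply: genericS (frontier_generic (neq0_open cY)) => w /= CY.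
    have [/CY|nw] := pselect (C w); last first.
      rewrite (cind_out nw); apply: le_trans (uO _ _ w); last by exists 0%N.
      exact: cind_ge0.
    move=> Yw; have : (0 < `|Y w|)%E.
      by rewrite lt_neqAle abse_ge0 eq_sym abse_eq0 Yw.
    move=> /EFin_between[q]; rewrite lte_fin => q0 qY.
    have [n nq] := ltr_add_invr q0; rewrite add0r in nq.
    apply: le_trans (cind_le1 _ _) _; apply: le_trans (uO _ _ w);
      last by exists n.
    rewrite cind_in//; apply: subset_closure; rewrite /O/=.
    by apply: lt_trans qY; rewrite lte_fin.
Qed.

(** The indicators of the support and of its complement give one decomposition of [cone]. In any
    decomposition, [P] vanishes off the support and [Q], being disjoint from [Y] itself, vanishes
    where [Y] does not; so whichever one [xget] picks has these values. *)
Lemma bandproj_spec Y : E Y -> E (bandproj E Y (@cone R K)) /\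
  generic [set w | bandproj E Y (@cone R K) w = ((Y w != 0%E)%:R)%:E].
Proof.
move=> EY; set P := bandproj _ _ _.
have oY := neq0_open (ideal_continuous EY).
have [oC cC oC' cC'] := closure_clopen oY.
set C := closure _ in oC cC oC' cC'.
pose S := [set P | band_gen E Y P /\
                   exists Q, band_disj E Y Q /\ @cone R K = cadd P Q].
have /(xgetPex (@czero R K)) SP : exists P, S P.
  exists (cind C); split; first exact: band_gen_support.
  exists (cind (~` C)); split.
    split=> [|W YW w]; first exact: ideal_cind.
    have [Cw|nw] := pselect (C w).
    - by rewrite cind_out ?abse0 ?min_l//; exact.
    - by rewrite (band_gen_vanish EY YW nw) abse0 min_r.
  apply/funext => w.
  have [_ ->] := cadd_spec KED (@cind_Cinf R K _ oC cC)
    (@cind_Cinf R K _ oC' cC').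
  - have [Cw|nw] := pselect (C w).
    + by rewrite (cind_in Cw) cind_out ?adde0//; exact.
    + by rewrite (cind_out nw) cind_in ?add0e.
  - by rewrite /cind; case: ifP.
  - by rewrite /cind; case: ifP.
have [YP [Q [[EQ YQ] PQ]]] : S P := SP.
have EP := band_gen_ideal EY YP; split => //.
have gP := Cinf_generic_fin (ideal_Cinf EP).
have gQ := Cinf_generic_fin (ideal_Cinf EQ).
apply: genericS (genericI (genericI gP gQ) (frontier_generic oY)).
move=> w /= [[Pw Qw] CY].
case: (eqVneq (Y w) 0%E) => [Y0|Yw]; last first.
- have : cadd P Q w = 1%E by rewrite -PQ.
  have [_ ->//] := cadd_spec KED (ideal_Cinf EP) (ideal_Cinf EQ).
  have : Q w = 0%E.
    have /eqP := YQ Y (fun B _ BY => BY) w; rewrite /Order.min.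
    by case: ifP => _; rewrite abse_eq0 ?(negbTE Yw)// => /eqP.
  by move=> ->; rewrite adde0.
- by apply: (band_gen_vanish EY YP) => /CY/=; rewrite Y0 eqxx.
Qed.

End Ideal.

(** * Sums of indicators of disjoint sets *)

Section DisjointSums.
Context {R : realType} {T : Type}.
Implicit Types (s : seq T) (S : T -> set R).

Lemma In_nth (x0 p : T) s : List.In p s ->
  exists2 k, (k < size s)%N & nth x0 s k = p.
Proof.
elim: s => //= q s IH [->|/IH[k ks kp]]; first by exists 0%N.
by exists k.+1.
Qed.

(** Indexed by positions, in the shape used by [fset_ok] and [step_rep]; an entry that occurs twice
    must have an empty set. *)
Definition pairwise_disjoint (x0 : T) S s := forall m n, (m < n < size s)%N ->
  S (nth x0 s m) `&` S (nth x0 s n) = set0.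

Lemma pairwise_disjoint_behead x0 S p s :
  pairwise_disjoint x0 S (p :: s) -> pairwise_disjoint x0 S s.
Proof. by move=> H m n mn; apply: (H m.+1 n.+1). Qed.

Lemma pairwise_disjoint_head x0 S p q s t :
  pairwise_disjoint x0 S (p :: s) -> List.In q s -> S p t -> ~ S q t.
Proof.
move=> H /(In_nth x0)[k ks kq] Sp Sq.
by have : set0 t by rewrite -(H 0%N k.+1) //=; split; rewrite //= kq.
Qed.

Lemma sum_indic_out (c : T -> R) S s t : (forall p, List.In p s -> ~ S p t) ->
  \sum_(p <- s) c p * \1_(S p) t = 0.
Proof.
elim: s => [|p s IH] Hs; first by rewrite big_nil.
rewrite big_cons IH ?addr0; last by move=> q qs; apply: Hs; right.
by rewrite indicE memNset ?mulr0//; apply: Hs; left.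
Qed.

Lemma sum_indic_in (c : T -> R) x0 S s p t : pairwise_disjoint x0 S s ->
  List.In p s -> S p t -> \sum_(q <- s) c q * \1_(S q) t = c p.
Proof.
elim: s => //= q s IH Hs [qp|ps] Sp; rewrite big_cons.
- subst q; rewrite sum_indic_out ?addr0 ?indicE ?mem_set ?mulr1//.
  by move=> r rs; exact: pairwise_disjoint_head Hs rs Sp.
- rewrite (IH (pairwise_disjoint_behead Hs))// indicE memNset ?mulr0 ?add0r//.
  by move=> /(pairwise_disjoint_head Hs ps); exact.
Qed.

End DisjointSums.

(** * Elements of [E] given by functions of [X], and the Daniell integral *)

Section Representation.
Context {R : realType} {K : topologicalType}.
Hypotheses (Kc : compact [set: K]) (KT2 : hausdorff_space K).
Hypothesis KED : extremally_disconnected K.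
Variable E : set (K -> \bar R).
Hypotheses (EI : is_ideal_in (@Cinf R K) E) (E1 : E (@cone R K)).
Variable X : K -> \bar R.
Hypothesis EX : E X.
Implicit Types (Y Z : K -> \bar R) (phi psi : R -> R).

(** A functional calculus up to generic sets. Membership in [E] provides continuity, so that [phi]
    determines [Z] by the Baire property. *)
Definition represents Z phi :=
  E Z /\ generic [set w | Z w = (phi (fine (X w)))%:E].

Lemma represents_eq Z phi psi : phi =1 psi ->
  represents Z phi -> represents Z psi.
Proof. by move=> /funext ->. Qed.

Lemma represents_cst (a : R) : E (fun=> a%:E) ->
  represents (fun=> a%:E) (fun=> a).
Proof. by move=> Ea; split => //; exact: genericT. Qed.

Lemma represents_czero : represents (@czero R K) (fun=> 0).
Proof. exact: (represents_cst (ideal_czero EI)). Qed.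

Lemma represents_cone : represents (@cone R K) (fun=> 1).
Proof. exact: (represents_cst E1). Qed.

Lemma represents_id : represents X id.
Proof.
split => //; apply: genericS (Cinf_generic_fin (ideal_Cinf EI EX)) => w.
by move=> Xw /=; rewrite fineK.
Qed.

Lemma represents_cadd Y Z phi psi : represents Y phi -> represents Z psi ->
  represents (cadd Y Z) (fun x => phi x + psi x).
Proof.
move=> [EY gY] [EZ gZ]; split; first exact: ideal_cadd.
apply: genericS (genericI gY gZ) => w /= [Yw Zw].
have [_ ->] := cadd_spec KED (ideal_Cinf EI EY) (ideal_Cinf EI EZ).
- by rewrite Yw Zw EFinD.
- by rewrite Yw.
- by rewrite Zw.
Qed.

Lemma represents_cscale c Z phi : represents Z phi ->
  represents (cscale c Z) (fun x => c * phi x).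
Proof.
move=> [EZ gZ]; split; first exact: ideal_cscale.
by apply: genericS gZ => w /= Zw; rewrite /cscale Zw EFinM.
Qed.

Lemma represents_csub Y Z phi psi : represents Y phi -> represents Z psi ->
  represents (csub Y Z) (fun x => phi x - psi x).
Proof.
move=> rY rZ; apply: represents_eq
  (represents_cadd rY (represents_cscale (-1) rZ)) => x.
by rewrite mulN1r.
Qed.

Lemma represents_csum (I : Type) (s : seq I) (F : I -> K -> \bar R)
    (phi : I -> R -> R) : (forall i, List.In i s -> represents (F i) (phi i)) ->
  represents (csum [seq F i | i <- s]) (fun x => \sum_(i <- s) phi i x).
Proof.
elim: s => [|i s IH] Hs /=.
  by apply: represents_eq represents_czero => x; rewrite big_nil.
have rs := IH (fun j js => Hs j (or_intror js)).
apply: represents_eq (represents_cadd (Hs i (or_introl erefl)) rs) => x.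
by rewrite big_cons.
Qed.

Lemma represents_cpos Z phi : represents Z phi ->
  represents (cpos Z) (fun x => Num.max (phi x) 0).
Proof.
move=> [EZ gZ]; split.
  apply: (ideal_solid EI EZ); first exact: (cpos_Cinf (ideal_Cinf EI EZ)).
  move=> w; rewrite /cpos; case: (leP (Z w) 0%E) => // _.
  by rewrite abse0 abse_ge0.
by apply: genericS gZ => w /= Zw; rewrite /cpos Zw -EFin_max.
Qed.

Lemma represents_bandproj Y phi : represents Y phi ->
  represents (bandproj E Y (@cone R K)) (fun x => (phi x != 0)%:R).
Proof.
move=> [EY gY]; have [EP gP] := bandproj_spec Kc KT2 KED EI E1 EY.
split => //; apply: genericS (genericI gY gP) => w /= [Yw ->].
by rewrite Yw eqe.
Qed.

(** The positive part of [x - t] is nonzero exactly for [t < x], so the indicator of that ray is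
    what is subtracted from 1. *)
Lemma represents_spec t : represents (spec E X t) (fun x => (x <= t)%R%:R).
Proof.
rewrite /spec; apply: represents_eq (represents_csub represents_cone
  (represents_bandproj (represents_cpos (represents_csub represents_id
    (represents_cscale t represents_cone))))) => x /=.
rewrite mulr1; have [xt|tx] := leP x t.
- by rewrite max_r ?subr_le0// eqxx subr0.
- by rewrite max_l ?subr_ge0 ?ltW// subr_eq0 gt_eqF// subrr.
Qed.

Lemma represents_cle Y Z phi psi : represents Y phi -> represents Z psi ->
  (forall x, phi x <= psi x) -> cle Y Z.
Proof.
move=> [EY gY] [EZ gZ] le_phi.
apply: (generic_cle Kc KT2); try exact: (ideal_continuous EI).
by apply: genericS (genericI gY gZ) => w /= [-> ->]; rewrite lee_fin.
Qed.

(** Countably many levels keep the property generic; [a = 1] and [a = -1] serve the limits at the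
    two infinities. *)
Lemma generic_spec_nat (a : R) : generic [set w | forall n : nat,
  spec E X (a * n%:R) w = ((fine (X w) <= a * n%:R)%R%:R)%:E].
Proof.
by apply: generic_forall => n; have [] := represents_spec (a * n%:R).
Qed.

(** By the Archimedean property, at a generic point [w] some spectral element of natural level
    equals 1, so every upper bound is at least 1 there. *)
Lemma spec_pinftyE : spec_pinfty E X = @cone R K.
Proof.
have lub1 : lub_in E (range (spec E X)) (@cone R K).
  split => //; split=> [_ [t _ <-]|u Eu su].
    apply: represents_cle (represents_spec t) represents_cone _ => x.
    by case: (x <= t).
  apply: (generic_cle Kc KT2); try exact: (ideal_continuous EI).
  apply: genericS (generic_spec_nat 1) => w /= /(_ _) sw.
  have := archi_boundP (normr_ge0 (fine (X w))); set n := Num.bound _ => xn.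
  have := sw n; rewrite mul1r (le_trans (ler_norm _) (ltW xn)) /cone => <-.
  by apply: su; exists n%:R.
have [Es [sub lub]] := xgetI (@czero R K) lub1.
by apply: cle_anti; [exact: (lub _ lub1.1 lub1.2.1)|exact: (lub1.2.2 _ Es sub)].
Qed.

Lemma spec_minftyE : spec_minfty E X = @czero R K.
Proof.
have glb0 : glb_in E (range (spec E X)) (@czero R K).
  split; first exact: (ideal_czero EI).
  split=> [_ [t _ <-]|u Eu us].
    by apply: represents_cle represents_czero (represents_spec t) _ => x.
  apply: (generic_cle Kc KT2); try exact: (ideal_continuous EI).
    exact: (ideal_continuous EI (ideal_czero EI)).
  apply: genericS (generic_spec_nat (-1)) => w /= /(_ _) sw.
  have := archi_boundP (normr_ge0 (fine (X w))); set n := Num.bound _ => xn.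
  (* From [|x| < n] follows [-n < x], so the spectral element of level [-n] is zero at [w]. *)
  have := sw n; rewrite leNgt (_ : -1 * _ < _) /=; last first.
    by move: xn; rewrite mulN1r ltr_norml => /andP[].
  move=> s0; apply: (@le_trans _ _ (spec E X (-1 * n%:R) w)); last first.
    by rewrite s0.
  by apply: us; exists (-1 * n%:R).
have [Es [sub glb]] := xgetI (@czero R K) glb0.
by apply: cle_anti; [exact: (glb0.2.2 _ Es sub)|exact: (glb _ glb0.1 glb0.2.1)].
Qed.

(** For [IOC a b], the condition [a < b] makes the difference of the two ray indicators an
    indicator. *)
Lemma represents_mu_ival i : ival_ok i ->
  represents (mu_ival E X i) (\1_(ival_set i)).
Proof.
case: i => [a b|a|b] /= ok; rewrite ?spec_pinftyE ?spec_minftyE.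
- apply: represents_eq
    (represents_csub (represents_spec b) (represents_spec a)) => x.
  rewrite indicE; have [xa|ax] := leP x a.
    rewrite (le_trans xa (ltW ok)) subrr memNset//=.
    by rewrite ltNge xa.
  rewrite subr0; have [xb|bx] := leP x b; first by rewrite mem_set//= ax.
  by rewrite memNset//= ax leNgt bx.
- apply: represents_eq
    (represents_csub represents_cone (represents_spec a)) => x.
  rewrite indicE; have [xa|ax] := leP x a.
    by rewrite subrr memNset//= ltNge xa.
  by rewrite subr0 mem_set.
- apply: represents_eq
    (represents_csub (represents_spec b) represents_czero) => x.
  rewrite indicE subr0; have [xb|bx] := leP x b; first by rewrite mem_set.
  by rewrite memNset//= leNgt bx.
Qed.

Lemma represents_mu_fset s : fset_ok s ->
  represents (mu_fset E X s) (\1_(fset_of s)).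
Proof.
move=> [ok dis].
have rs i : List.In i s -> represents (mu_ival E X i) (\1_(ival_set i)).
  move=> iI; apply: represents_mu_ival; have [k ks <-] := In_nth (IIC 0) iI.
  exact: (all_nthP _ ok).
apply: represents_eq (represents_csum rs) => x.
transitivity (\sum_(i <- s) 1 * \1_(ival_set i) x : R).
  by apply: eq_bigr => i _; rewrite mul1r.
rewrite [RHS]indicE; have [[i iI ix]|nx] := pselect (fset_of s x).
- by rewrite (sum_indic_in (fun=> 1) dis iI ix) mem_set//; exists i.
- rewrite sum_indic_out ?memNset// => i iI ix.
  by apply: nx; exists i.
Qed.

(** The weighted indicators of every step representation add up to [phi], so the choice hidden in
    [IL] is harmless. *)
Lemma represents_IL phi : inL phi -> represents (IL E X phi) phi.
Proof.
move=> [r0 Hr0].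
pose S := [set v | exists r, step_rep phi r /\
  v = csum [seq cscale p.1 (mu_fset E X p.2) | p <- r]].
have [r [[ok [_ [_ phiE]]] ->]] : S (IL E X phi).
  apply: (@xgetPex _ (@czero R K) S).
  by eexists; exists r0; split; first exact: Hr0.
apply: represents_eq (represents_csum
  (F := fun p => cscale p.1 (mu_fset E X p.2))
  (phi := fun p x => p.1 * \1_(fset_of p.2) x) _) => [x|p pr].
- by rewrite phiE.
- by apply/represents_cscale/represents_mu_fset; exact: ok.
Qed.

Lemma lub_in_unique S A (u v : K -> \bar R) :
  lub_in S A u -> lub_in S A v -> u = v.
Proof.
move=> [Su [Au uA]] [Sv [Av vA]].
by apply: cle_anti; [exact: uA|exact: vA].
Qed.

(** Let [s] be the pointwise supremum of the integrals [IL], which are continuous. Its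
    regularization is the least continuous majorant, hence the supremum in [Esup], and generically
    it equals [s], which is the limit of [fn n] at the value of [X]. *)
Lemma up_seq_lub phi fn : up_seq (fun t => (phi t)%:E) fn ->
  exists v, [/\ lub_in (Esup E) (range (fun n => IL E X (fn n))) v,
    continuous v & generic [set w | v w = (phi (fine (X w)))%:E]].
Proof.
move=> [fnL [fn_up fn_cvg]].
have rIL n := represents_IL (fnL n).
pose s w := ereal_sup (range (fun n => IL E X (fn n) w)).
have sl : lower_semicontinuous s.
  apply/lower_semicontinuousP => a.
  rewrite (_ : [set _ | _] = \bigcup_n [set w | (a%:E < IL E X (fn n) w)%E]).
    apply: bigcup_open => n _; apply: continuous_open_gt.
    exact: (ideal_continuous EI (rIL n).1).
  apply/seteqP; split => w /=.
  + by move=> /ereal_sup_gt[_ [n _ <-] an]; exists n.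
  + move=> [n _ /= an]; apply: lt_le_trans an _.
    by apply: ereal_sup_ubound; exists n.
have cs := creg_continuous KED sl.
have sge n : cle (IL E X (fn n)) (creg s).
  move=> w; apply: le_trans (creg_ge s w).
  by apply: ereal_sup_ubound; exists n.
exists (creg s); split => //.
- split.
    split => //; exists (IL E X (fn 0%N)); split => //.
    exact: (rIL 0%N).1.
  split=> [_ [n _ <-]|u [cu _] uA]; first exact: sge.
  apply: creg_le_continuous => // w; apply: ub_ereal_sup => _ [n _ <-].
  by apply: uA; exists n.
- have gIL : generic [set w | forall n,
      IL E X (fn n) w = (fn n (fine (X w)))%:E].
    by apply: generic_forall => n; exact: (rIL n).2.
  apply: genericS (genericI gIL (creg_generic sl)) => w /= [ILw ->].
  set t := fine (X w) in ILw *.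
  rewrite /s (_ : (fun n => _) = (fun n => (fn n t)%:E)); last exact/funext.
  apply: (@cvg_unique _ (@ereal_hausdorff R) _ _ _ _ _ (fn_cvg t)).
  apply: ereal_nondecreasing_cvgn => m n /subnKC <-.
  elim: (n - m)%N => [|k IH]; first by rewrite addn0.
  by rewrite addnS; apply: le_trans IH _; rewrite lee_fin.
Qed.

Lemma Iup_spec phi : inLup (fun t => (phi t)%:E) ->
  continuous (Iup E X (fun t => (phi t)%:E)) /\
  generic [set w | Iup E X (fun t => (phi t)%:E) w = (phi (fine (X w)))%:E].
Proof.
move=> [fn0 up0]; have [v0 [lub0 _ _]] := up_seq_lub up0.
pose S := [set v | exists fn, up_seq (fun t => (phi t)%:E) fn /\
  lub_in (Esup E) (range (fun n => IL E X (fn n))) v].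
have [fn [up lub]] : S (Iup E X (fun t => (phi t)%:E)).
  by apply: (@xgetPex _ (@czero R K) S); exists v0, fn0.
have [v [lubv cv gv]] := up_seq_lub up.
by rewrite (lub_in_unique lub lubv).
Qed.

(** The decomposition is arbitrary: both sides lie in [Cinf] and agree wherever [X] is finite and
    the two integrals take the values [g] and [h] of [X]. *)
Lemma Lu_dec_csub f g h : continuous f -> Lu_dec E X f g h ->
  csub (Iup E X (fun t => (g t)%:E)) (Iup E X (fun t => (h t)%:E)) = ccomp f X.
Proof.
move=> cf [[_ gL] [[_ hL] [Cg [Ch fE]]]].
have [_ gg] := Iup_spec gL; have [_ gh] := Iup_spec hL.
have [CF FE] := ccomp_spec KED cf (ideal_Cinf EI EX).
have [CD DE] := csub_spec KED Cg Ch.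
apply: (generic_eq Kc KT2); [exact: CD.1|exact: CF.1|].
have gX := Cinf_generic_fin (ideal_Cinf EI EX).
apply: genericS (genericI (genericI gg gh) gX) => w /= [[gw hw] Xw].
by rewrite FE// DE ?gw ?hw// fE.
Qed.

(** Through [ccomp_spec], this puts the integral in [Cinf], as [Lu_dec] demands. *)
Lemma Iup_continuous phi : continuous phi -> inLup (fun t => (phi t)%:E) ->
  Iup E X (fun t => (phi t)%:E) = ccomp phi X.
Proof.
move=> cphi /Iup_spec[cI gI].
have [CF FE] := ccomp_spec KED cphi (ideal_Cinf EI EX).
apply: (generic_eq Kc KT2) => //; first exact: CF.1.
have gX := Cinf_generic_fin (ideal_Cinf EI EX).
by apply: genericS (genericI gI gX) => w /= [-> Xw]; rewrite FE.
Qed.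

End Representation.

(** * Step functions and approximation of continuous functions from below *)

Section StepFunctions.
Context {R : realType}.
Implicit Types (phi psi : R -> R) (s l : seq R) (a b t u : R).

(** Two points lie in the same left-open, right-closed piece cut out by [s] when they compare alike
    with every cut point. In this form, a maximum of two functions is handled by concatenating their
    lists. *)
Definition constant_between s phi := forall t u,
  (forall a, a \in s -> (t <= a) = (u <= a)) -> phi t = phi u.

(** A bounded piece contains its right endpoint, which serves as sample point; on the last,
    unbounded piece the sample is [a + 1]. *)
Fixpoint step_tail phi a l : seq (R * seq (ival R)) :=
  if l is b :: l' then (phi b, [:: IOC a b]) :: step_tail phi b l'
  else [:: (phi (a + 1), [:: IOI a])].

Lemma fset_of1 (i : ival R) : fset_of [:: i] = ival_set i.
Proof.
apply/seteqP; split=> t; first by move=> [j [->|[]]].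
by move=> it; exists i => //; left.
Qed.

Lemma fset_ok1 (i : ival R) : ival_ok i -> fset_ok [:: i].
Proof.
move=> oki; split; first by rewrite /= oki.
by move=> m [|n] /andP[] //=; rewrite ltnS ltn0.
Qed.

Lemma nth_In (T : Type) (x0 : T) (s : seq T) k :
  (k < size s)%N -> List.In (nth x0 s k) s.
Proof. by elim: s k => //= x s IH [|k] ks; [left|right; exact: IH]. Qed.

Lemma pairwise_disjoint_cons (T : Type) (x0 : T) (S : T -> set R) p
    (s : seq T) :
  (forall q, List.In q s -> S p `&` S q = set0) ->
  pairwise_disjoint x0 S s -> pairwise_disjoint x0 S (p :: s).
Proof.
move=> Hp Hs [|m] [|n] //= mn; last exact: Hs.
by apply: Hp; exact: nth_In.
Qed.

Lemma step_tail_ok phi a l p : path <%R a l ->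
  List.In p (step_tail phi a l) -> fset_ok p.2.
Proof.
elim: l a => [|b l IH] a /=; first by move=> _ [<-|[]]; exact: fset_ok1.
by move=> /andP[ab bl] [<-|]; [exact: fset_ok1|exact: IH].
Qed.

Lemma step_tail_gt phi a l p t : path <%R a l ->
  List.In p (step_tail phi a l) -> fset_of p.2 t -> a < t.
Proof.
elim: l a => [|b l IH] a /=; first by move=> _ [<-|[]]; rewrite fset_of1.
move=> /andP[ab bl] [<-|pl]; first by rewrite fset_of1 => /andP[].
by move=> /(IH _ bl pl); exact: lt_trans.
Qed.

Lemma step_tail_disjoint phi a l : path <%R a l ->
  pairwise_disjoint (0, [::]) (fun p => fset_of p.2) (step_tail phi a l).
Proof.
elim: l a => [|b l IH] a /=.
  by move=> _; apply: pairwise_disjoint_cons => // m n /andP[].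
move=> /andP[ab bl]; apply: pairwise_disjoint_cons; last exact: IH.
move=> q ql; apply/seteqP; split => // t [] /=.
by rewrite fset_of1/= => /andP[_ tb] /(step_tail_gt bl ql); rewrite ltNge tb.
Qed.

(** Above [a], cut points up to [a] separate nothing. Asking for constancy only there lets the
    induction drop the head of [l]. *)
Lemma step_tail_cover phi a l t : path <%R a l ->
  (forall t u, a < t -> a < u ->
    (forall x, x \in l -> (t <= x) = (u <= x)) -> phi t = phi u) ->
  a < t ->
  exists2 p, List.In p (step_tail phi a l) & fset_of p.2 t /\ phi t = p.1.
Proof.
elim: l a => [|b l IH] a /=.
  move=> _ H at_; exists (phi (a + 1), [:: IOI a]); first by left.
  by split; [rewrite fset_of1|apply: H => //; rewrite ltrDl].
move=> /andP[ab bl] H at_; have [tb|bt] := leP t b.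
- exists (phi b, [:: IOC a b]); first by left.
  split; first by rewrite fset_of1/= at_.
  apply: H => // x; rewrite inE => /orP[/eqP ->|xl]; first by rewrite tb lexx.
  have bx : b <= x by have /allP/(_ x xl)/ltW := order_path_min lt_trans bl.
  by rewrite bx (le_trans tb bx).
- suff Hb : forall v w, b < v -> b < w ->
      (forall x, x \in l -> (v <= x) = (w <= x)) -> phi v = phi w.
    by have [p pl Hp] := IH b bl Hb bt; exists p => //; right.
  move=> v w bv bw H'.
  apply: H => [||x]; [exact: lt_trans bv|exact: lt_trans bw|].
  rewrite inE => /orP[/eqP ->|]; last exact: H'.
  by rewrite !leNgt bv bw.
Qed.

Lemma inL_constant_between s phi : constant_between s phi -> inL phi.
Proof.
(* Adding [0] ensures a leftmost cut point, at which the piece unbounded below ends; removing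
   duplicates makes the order strict. *)
move=> cphi; set s' := sort <=%R (undup (0 :: s)).
have : sorted <%R s' by rewrite sort_lt_sorted undup_uniq.
have : {subset s <= s'}.
  by move=> x xs; rewrite mem_sort mem_undup inE xs orbT.
have : 0 \in s' by rewrite mem_sort mem_undup mem_head.
case: s' => // a l _ sl al.
have cover t : exists2 p, List.In p ((phi a, [:: IIC a]) :: step_tail phi a l) &
    fset_of p.2 t /\ phi t = p.1.
  have [ta|at_] := leP t a.
    exists (phi a, [:: IIC a]); first by left.
    split; first by rewrite fset_of1.
    apply: cphi => x /sl; rewrite inE => /orP[/eqP ->|xl].
      by rewrite ta lexx.
    have ax : a <= x by have /allP/(_ x xl)/ltW := order_path_min lt_trans al.
    by rewrite ax (le_trans ta ax).
  suff Ha : forall v w, a < v -> a < w ->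
      (forall x, x \in l -> (v <= x) = (w <= x)) -> phi v = phi w.
    by have [p pl Hp] := step_tail_cover al Ha at_; exists p => //; right.
  move=> v w av aw H; apply: cphi => x /sl.
  rewrite inE => /orP[/eqP ->|]; last exact: H.
  by rewrite !leNgt av aw.
have disj : pairwise_disjoint (0, [::]) (fun p => fset_of p.2)
    ((phi a, [:: IIC a]) :: step_tail phi a l).
  apply: pairwise_disjoint_cons; last exact: step_tail_disjoint.
  move=> q ql; apply/seteqP; split => // t [] /=; rewrite fset_of1/= => ta.
  by move=> /(step_tail_gt al ql); rewrite ltNge ta.
exists ((phi a, [:: IIC a]) :: step_tail phi a l); split.
  by move=> p [<-|]; [exact: fset_ok1|exact: step_tail_ok].
split; first exact: disj.
split=> t; have [p pr [pt phit]] := cover t; first by exists p.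
by rewrite (sum_indic_in (fun p => p.1) disj pr pt).
Qed.

(* [c = (a, p, q)] encodes [a * 1_(p, q]]. *)
Definition block (c : rat * rat * rat) t : R :=
  if ratr c.1.2 < t <= ratr c.2 then ratr c.1.1 else 0.

Lemma block_constant_between c :
  constant_between [:: ratr c.1.2; ratr c.2] (block c).
Proof.
move=> t u H; rewrite /block !(ltNge (ratr c.1.2)).
by rewrite !H// !inE eqxx ?orbT.
Qed.

(** Numbers that code no block, and blocks not below [phi], contribute 0, which is harmless for
    nonnegative [phi]. *)
Definition block_below phi k : R -> R :=
  if unpickle k is Some c then
    if `[< forall t, block c t <= phi t >] then block c else fun=> 0
  else fun=> 0.

Fixpoint lower_step phi n t : R :=
  if n is m.+1 then Num.max (lower_step phi m t) (block_below phi m t) else 0.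

Lemma lower_step_inL phi n : inL (lower_step phi n).
Proof.
suff [s Hs] : exists s, constant_between s (lower_step phi n).
  exact: inL_constant_between Hs.
elim: n => [|n [s Hs]]; first by exists [::].
have [s' Hs'] : exists s, constant_between s (block_below phi n).
  rewrite /block_below; case: (unpickle n) => [c|]; last by exists [::].
  case: asboolP => _; last by exists [::].
  by exists [:: ratr c.1.2; ratr c.2]; exact: block_constant_between.
exists (s ++ s') => t u H /=; congr (Num.max _ _).
- by apply: Hs => x xs; apply: H; rewrite mem_cat xs.
- by apply: Hs' => x xs; apply: H; rewrite mem_cat xs orbT.
Qed.

Lemma lower_step_le phi n t : (forall t, 0 <= phi t) ->
  lower_step phi n t <= phi t.
Proof.
move=> phi0; elim: n => //= n IH; rewrite ge_max IH /=.
by rewrite /block_below; case: (unpickle n) => [c|] //; case: asboolP.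
Qed.

Lemma block_le_lower_step phi c n t : (forall t, block c t <= phi t) ->
  (pickle c < n)%N -> block c t <= lower_step phi n t.
Proof.
move=> cphi; elim: n => //= n IH; rewrite ltnS leq_eqVlt le_max.
move=> /orP[/eqP <-|/IH ->//]; rewrite /block_below pickleK.
by case: asboolP => // _; rewrite lexx orbT.
Qed.

(** At [t], take a rational [a] between [phi t - e] and [phi t], and a rational interval around [t]
    on which [phi] exceeds [a]. This block lies below [phi], and once it has entered, the lower
    steps stay within [e] of [phi t]. *)
Lemma continuous_inLup phi : continuous phi -> (forall t, 0 <= phi t) ->
  inLup (fun t => (phi t)%:E).
Proof.
move=> cphi phi0; exists (lower_step phi); split; first exact: lower_step_inL.
split=> [n t|t]; first by rewrite /= le_max lexx.
apply: cvg_EFin; first exact: nearW.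
apply/cvgrPdist_lt => e e0.
have [a ea at_] : exists2 a : rat, phi t - e < ratr a & ratr a < phi t.
  have /rat_in_itvoo[a] : phi t - e < phi t by rewrite gtrBl.
  by rewrite in_itv => /andP[]; exists a.
have /nbhs_ballP[d /= d0 dphi] : \forall u \near t, ratr a < phi u.
  by apply: (cphi t [set y | ratr a < y]); exact: lt_nbhsr.
have [p dp pt] : exists2 p : rat, t - d < ratr p & ratr p < t.
  have /rat_in_itvoo[p] : t - d < t by rewrite gtrBl.
  by rewrite in_itv => /andP[]; exists p.
have [q tq qd] : exists2 q : rat, t < ratr q & ratr q < t + d.
  have /rat_in_itvoo[q] : t < t + d by rewrite ltrDl.
  by rewrite in_itv => /andP[]; exists q.
have below u : block (a, p, q) u <= phi u.
  rewrite /block; case: ifPn => // /andP[/= pu uq]; apply/ltW/dphi.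
  by rewrite /ball/= ltr_norml; lra.
(* The [n]-th lower step takes in the codes below [n], hence the successor. *)
exists (pickle (a, p, q)).+1 => // n /= an.
have le_n := lower_step_le n t phi0.
have := block_le_lower_step t below an.
rewrite /block/= pt (ltW tq) /= => an_le.
by rewrite ltr_norml; lra.
Qed.

End StepFunctions.

Theorem mainTheorem6 (R : realType) (K : topologicalType)
  (E : set (K -> \bar R)) (X : K -> \bar R) :
  compact [set: K] -> hausdorff_space K -> extremally_disconnected K ->
  is_ideal_in (@Cinf R K) E -> order_dense_in E -> E (@cone R K) ->
  E X ->
  forall f : R -> R, continuous f ->
    inLu E X f /\ Iu E X f = ccomp f X /\ Cinf (Iu E X f).
Proof.
move=> Kc KT2 KED EI _ E1 EX f cf.
(* The positive and negative parts of [f] are continuous, so each has a composition with [X] as its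
   integral. *)
pose g t := Num.max (f t) 0; pose h t := Num.max (- f t) 0.
have c0 : continuous (fun _ : R => 0 : R^o) by move=> t; exact: cst_continuous.
have cg : continuous g by move=> t; exact: (continuous_max (cf t) (c0 t)).
have ch : continuous h.
  by move=> t; exact: (continuous_max (continuousN (cf t)) (c0 t)).
have g0 t : 0 <= g t by rewrite le_max lexx orbT.
have h0 t : 0 <= h t by rewrite le_max lexx orbT.
have gL := continuous_inLup cg g0; have hL := continuous_inLup ch h0.
have CX := ideal_Cinf EI EX.
have dec : Lu_dec E X f g h.
  split=> //; split=> //.
  rewrite !(Iup_continuous Kc KT2 KED EI E1 EX)//.
  split; first by have [] := ccomp_spec KED cg CX.
  split; first by have [] := ccomp_spec KED ch CX.
  apply/funext => t; rewrite /g /h /=.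
  have [ft|ft] := leP (f t) 0; first by rewrite max_l ?oppr_ge0// opprK add0r.
  by rewrite max_r ?oppr_le0 ?ltW// subr0.
have IuE : Iu E X f = ccomp f X.
  (* [Iu] may rest on another decomposition of [f]; each of them yields [ccomp f X]. *)
  pose S := [set v | exists g h, Lu_dec E X f g h /\
    v = csub (Iup E X (fun t => (g t)%:E)) (Iup E X (fun t => (h t)%:E))].
  have [g' [h' [dec' ->]]] : S (Iu E X f).
    by apply: (@xgetPex _ (@czero R K) S); eexists; exists g, h; split.
  exact: (Lu_dec_csub Kc KT2 KED EI E1 EX cf dec').
split; first by exists g, h.
by split; rewrite IuE //; have [] := ccomp_spec KED cf CX.
Qed.
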